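(* Let $q=r^2$ where $r$ is an odd prime power, and let $q-1=e_1f_1=e_2f_2$ with positive integers $e_1,f_1,e_2,f_2$. Suppose there is an integer $l\geq 2$ with $e_1\equiv 2^l \pmod{2^{l+1}}$ and $2^l\mid e_2$. Suppose further that $2e_2\mid e_1(r-1)$ and $e_1\mid e_2(r+1)$. Let $D_1=\frac{e_1}{\gcd(e_1,e_2)}$, $D_2=\frac{e_2}{\gcd(e_1,e_2)}$, and let $s,t$ be integers with $1\leq s\leq D_1$, $1\leq t\leq D_2$ and $4\mid (s-1)(r+1)$. Put $n_1=sf_1+tf_2$. Then: (1) if $n_1$ is even, then for every $k$ with $1\leq k\leq \frac{n_1}{2}-1$ there exists a $q$-ary $[n_1,k]$ MDS self-orthogonal code; (2) if $n_1$ is even, there exists a $q$-ary MDS almost self-dual code of length $n_1+1$; (3) if $n_1+1$ is even, then for every $k$ with $1\leq k\leq \frac{n_1+1}{2}-1$ there exists a $q$-ary $[n_1+1,k]$ MDS self-orthogonal code.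
   Context: $\mathbb{F}_q$ denotes the finite field with $q$ elements. A linear code of length $n$ over $\mathbb{F}_q$ is a subspace of $\mathbb{F}_q^n$; an $[n,k]$ code has dimension $k$, and an $[n,k,d]$ code is MDS if its minimum Hamming distance is $d=n-k+1$. The (Euclidean) dual of a code $C$ is $C^\perp=\{x\in\mathbb{F}_q^n : \sum_i x_ic_i=0 \text{ for all } c\in C\}$. $C$ is self-orthogonal if $C\subseteq C^\perp$, and almost self-dual if $C\subseteq C^\perp$ and $\dim C^\perp=\dim C+1$. An MDS almost self-dual code is an almost self-dual code that is MDS. *)

(* Defs.v *)
From HB Require Import structures.
From mathcomp Require Import all_boot all_order all_algebra all_field.
Set Implicit Arguments. Unset Strict Implicit. Unset Printing Implicit Defensive.
Import GRing.Theory.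
Local Open Scope ring_scope.

(* A linear code of length n over F is represented (mxalgebra style) by a
   square matrix C : 'M[F]_n whose row space is the code.
   x is a codeword iff (x <= C)%MS; dim C = \rank C. *)

Definition wt (F : fieldType) (n : nat) (x : 'rV[F]_n) : nat :=
  #|[set i : 'I_n | x 0 i != 0]|.

Definition has_min_dist (F : fieldType) (n : nat) (C : 'M[F]_n) (d : nat) : Prop :=
  (exists x : 'rV[F]_n, [/\ (x <= C)%MS, x != 0 & wt x = d]) /\
  (forall x : 'rV[F]_n, (x <= C)%MS -> x != 0 -> (d <= wt x)%N).

Definition is_MDS (F : fieldType) (n : nat) (C : 'M[F]_n) : Prop :=
  has_min_dist C (n - \rank C + 1).

(* Euclidean dual: the row space of kermx C^T is {x | x *m c^T = 0 for all rows c of C}. *)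
Definition dual_code (F : fieldType) (n : nat) (C : 'M[F]_n) : 'M[F]_n :=
  kermx C^T.

Definition self_orthogonal (F : fieldType) (n : nat) (C : 'M[F]_n) : bool :=
  (C <= dual_code C)%MS.

Definition almost_self_dual (F : fieldType) (n : nat) (C : 'M[F]_n) : Prop :=
  self_orthogonal C /\ \rank (dual_code C) = (\rank C + 1)%N.

Definition odd_prime_power (r : nat) : Prop :=
  odd r /\ exists p m : nat, [/\ prime p, (0 < m)%N & r = p ^ m]%N.

(* Main.v *)
(* If P is split of degree n over F and P'(x) is a nonzero square at each of its
   n roots, scaling Reed-Solomon codes on these roots by v_x with
   v_x^2 = 1 / P'(x) gives self-orthogonal MDS codes of every dimension k <= n/2,
   because the sum of h(x) / P'(x) over the roots vanishes when deg h < n - 1.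

   With g = gcd(e1,e2), a1 = e1/g (odd), a2 = e2/g, we have f1 = a2 w and
   f2 = a1 w, a1 divides (r+1)/2 and 2 a2 divides r-1.  The evaluation points are
   the roots of P = prod_i (X^f1 - y_i) * prod_j (X^f2 - z_j), where the y_i are
   s distinct roots of X^a1 = 1 and the z_j are t distinct roots of X^a2 = -1.
   The two families are disjoint since their points satisfy x^(a1 a2 w) = 1 and
   x^(a1 a2 w) = -1 respectively.  Every factor of x P'(x) is a square: it is some
   y_i, or lies in the subfield of order r, or is a difference of two elements of norm 1, whose
   quadratic character comes from (y - y')^(r-1) = -1/(y y').  All roots of P are
   squares, and so is P(0), so that X P satisfies the criterion as well and
   provides the codes of length n1 + 1. *)
Require Import Defs.
From HB Require Import structures.
From mathcomp Require Import all_boot all_order all_algebra all_field.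
From mathcomp Require Import zify ring.

Set Implicit Arguments.
Unset Strict Implicit.
Unset Printing Implicit Defensive.

Import GRing.Theory.
Local Open Scope ring_scope.

(** * Generalized Reed-Solomon codes with evaluation points [a] and column multipliers [v] *)

Definition grs_mx (F : fieldType) (n k : nat) (a v : 'I_n -> F) : 'M[F]_(k, n) :=
  \matrix_(i, j) (v j * a j ^+ i).

Lemma mul_grs_mx (F : fieldType) (n k : nat) (a v : 'I_n -> F) (c : 'rV_k) j :
  (c *m grs_mx k a v) 0 j = v j * (rVpoly c).[a j].
Proof.
rewrite (horner_coef_wide _ (size_poly k _)) mulr_sumr mxE.
by apply: eq_bigr => i _; rewrite mxE coef_rVpoly_ord mulrCA.
Qed.

Lemma card_zeros_leq (F : fieldType) (n k : nat) (a : 'I_n -> F) (p : {poly F}) :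
    injective a -> p != 0 -> (size p <= k)%N ->
  (#|[set j | p.[a j] == 0%R]| < k)%N.
Proof.
move=> inj_a p0 szp; set Z := [set j | _].
have /(max_poly_roots p0) : all (root p) [seq a j | j <- enum Z].
  by apply/allP => _ /mapP[j jZ ->]; move: jZ; rewrite mem_enum inE.
by rewrite map_inj_uniq // enum_uniq size_map -cardE => /(_ isT) /leq_trans; apply.
Qed.

Lemma wt_mul_grs_mx (F : fieldType) (n k : nat) (a v : 'I_n -> F) (c : 'rV_k) :
    (forall j, v j != 0) ->
  (wt (c *m grs_mx k a v) + #|[set j | (rVpoly c).[a j] == 0%R]| = n)%N.
Proof.
move=> v0; rewrite -[RHS]card_ord addnC.
rewrite -(cardC [pred j | (rVpoly c).[a j] == 0]).
by congr addn; apply: eq_card => j; rewrite !inE // mul_grs_mx mulf_eq0 negb_or v0.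
Qed.

(** A nonzero message polynomial of degree below [k] vanishes at fewer than [k] of the points
    [a j]. *)
Lemma grs_min_wt (F : fieldType) (n k : nat) (a v : 'I_n -> F) (c : 'rV_k) :
    injective a -> (forall j, v j != 0) -> (k <= n)%N -> c != 0 ->
  (n - k < wt (c *m grs_mx k a v))%N.
Proof.
move=> inj_a v0 kn c0; have wtE := wt_mul_grs_mx a c v0.
have pc0 : rVpoly c != 0 by apply: contraNneq c0 => pc0; rewrite -[c]rVpolyK pc0 linear0.
have := card_zeros_leq inj_a pc0 (size_poly _ _).
by lia.
Qed.

Lemma rank_grs_mx (F : fieldType) (n k : nat) (a v : 'I_n -> F) :
    injective a -> (forall j, v j != 0) -> (k <= n)%N ->
  \rank (grs_mx k a v) = k.
Proof.
move=> inj_a v0 kn; apply/eqP/inj_row_free => c cG0.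
apply/eqP/negPn/negP => /(grs_min_wt inj_a v0 kn); rewrite cG0 /wt.
rewrite (_ : [set i | _] = set0) ?cards0 //.
by apply/setP => i; rewrite !inE mxE eqxx.
Qed.

Lemma grs_MDS (F : fieldType) (n k : nat) (a v : 'I_n -> F) :
    injective a -> (forall j, v j != 0) -> (0 < k <= n)%N ->
  is_MDS <<grs_mx k a v>>%MS.
Proof.
move=> inj_a v0 /andP[k_gt0 kn].
rewrite /is_MDS mxrank_gen rank_grs_mx // addn1; split; last first.
  move=> x; rewrite genmxE => /submxP[c ->] cG0; apply: grs_min_wt => //.
  by apply: contraNneq cG0 => ->; rewrite mul0mx.
(* The minimum weight is attained by the polynomial vanishing at the first [k.-1] points: that many
   zero coordinates leave weight at most [n - k + 1]. *)
pose p := \prod_(i < k.-1) ('X - (a (widen_ord (leq_trans (leq_pred k) kn) i))%:P).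
have szp : (size p <= k)%N by rewrite size_prod_XsubC -sum1_size sum1_card card_ord prednK.
have p0 : p != 0 by apply: monic_neq0; apply: monic_prod_XsubC.
pose c : 'rV_k := poly_rV p.
have c0 : c != 0.
  by apply: contraNneq p0 => c0; rewrite -(poly_rV_K szp) -/c c0 linear0.
have wtx := wt_mul_grs_mx a c v0; have wt_gt := grs_min_wt inj_a v0 kn c0.
exists (c *m grs_mx k a v); split; first by rewrite genmxE submxMl.
  apply: contraTneq wt_gt => ->; rewrite /wt (_ : [set i | _] = set0) ?cards0 //.
  by apply/setP => i; rewrite !inE mxE eqxx.
suff : (k.-1 <= #|[set j | (rVpoly c).[a j] == 0%R]|)%N.
  by move: wtx wt_gt; set w := wt _; set z := #|_|; lia.
rewrite poly_rV_K // -[in leqLHS](card_ord k.-1).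
have inj_w : injective (widen_ord (leq_trans (leq_pred k) kn)).
  by move=> i j /(congr1 val) /= /val_inj.
rewrite -(card_imset _ inj_w).
apply/subset_leq_card/subsetP => _ /imsetP[i _ ->].
by rewrite inE horner_prod (bigD1 i) //= hornerXsubC subrr mul0r.
Qed.

(** Since [h] equals its own Lagrange interpolant at the [n] points, the sum is the coefficient of
    ['X^(n.-1)] in [h], which is zero for degree reasons. *)
Lemma lagrange_residue_sum (F : fieldType) (n : nat) (a : 'I_n -> F) (h : {poly F}) :
    injective a -> (size h < n)%N ->
  \sum_j h.[a j] / \prod_(i | i != j) (a j - a i) = 0.
Proof.
move=> inj_a szh.
pose Q j := \prod_(i | i != j) ('X - (a i)%:P).
have QE j i : (Q j).[a i] = \prod_(l | l != j) (a i - a l).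
  by rewrite horner_prod; apply: eq_bigr => l _; rewrite hornerXsubC.
have Q0 j : (Q j).[a j] != 0.
  rewrite QE; apply/prodf_neq0 => l lj.
  by rewrite subr_eq0 (inj_eq inj_a) eq_sym.
have Qij j i : i != j -> (Q j).[a i] = 0.
  by move=> ij; rewrite QE (bigD1 i) //= subrr mul0r.
have szQ j : size (Q j) = n.
  rewrite /Q -big_filter size_prod_XsubC -sum1_size big_filter sum1_card cardC1 card_ord.
  by rewrite (ltn_predK (ltn_ord j)).
pose L := \sum_j (h.[a j] / (Q j).[a j]) *: Q j.
have hL : h = L.
  apply/eqP; rewrite -subr_eq0; apply/eqP.
  apply: (@roots_geq_poly_eq0 _ _ [seq a j | j <- enum 'I_n]).
  - apply/allP => _ /mapP[j _ ->]; rewrite rootE hornerD hornerN horner_sum.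
    rewrite (bigD1 j) //= big1 => [|i ij].
      by rewrite addr0 hornerZ divfK ?subrr.
    by rewrite hornerZ (Qij i j) ?mulr0 1?eq_sym.
  - by rewrite map_inj_uniq ?enum_uniq.
  rewrite size_map -cardE card_ord (leq_trans (size_polyD _ _)) //.
  rewrite geq_max size_polyN (ltnW szh) /= (leq_trans (size_sum _ _ _)) //.
  by apply/bigmax_leqP => i _; rewrite (leq_trans (size_scale_leq _ _)) ?szQ.
have : L`_n.-1 = 0 by rewrite -hL nth_default // -ltnS (ltn_predK szh).
rewrite coef_sum => L0; rewrite -[RHS]L0; apply: eq_bigr => j _.
have /monicP : Q j \is monic by apply: monic_prod_XsubC.
by rewrite lead_coefE szQ coefZ QE => ->; rewrite mulr1.
Qed.

(** Entry [(i, j)] of the Gram matrix of [grs_mx] is the residue sum for ['X^(i + j)], a polynomial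
    of size at most [2 k - 1], hence below [n]. *)
Lemma grs_self_orthogonal (F : fieldType) (n k : nat) (a v : 'I_n -> F) :
    injective a -> (k.*2 <= n)%N ->
    (forall j, v j ^+ 2 = (\prod_(i | i != j) (a j - a i))^-1) ->
  self_orthogonal <<grs_mx k a v>>%MS.
Proof.
move=> inj_a kn v2; rewrite /self_orthogonal /dual_code.
apply/sub_kermxP; set C := <<_>>%MS.
have [D ->] : exists D, C = D *m grs_mx k a v by apply/submxP; rewrite genmxE.
have GGt0 : grs_mx k a v *m (grs_mx k a v)^T = 0.
  apply/matrixP => i j; rewrite !mxE -[RHS](@lagrange_residue_sum _ _ a 'X^(i + j)) //.
    by apply: eq_bigr => l _; rewrite !mxE hornerXn -v2 exprD; ring.
  by rewrite size_polyXn; have := ltn_ord i; have := ltn_ord j; lia.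
by rewrite trmx_mul mulmxA -(mulmxA D) GGt0 mulmx0 mul0mx.
Qed.

(** * Codes from split polynomials *)

Lemma deriv_square_code (F : fieldType) (rs : seq F) (P : {poly F}) (n k : nat) :
    P = \prod_(x <- rs) ('X - x%:P) -> size rs = n ->
    (forall x, root P x -> exists2 v, v != 0 & P^`().[x] = v ^+ 2) ->
    (0 < k)%N -> (k.*2 <= n)%N ->
  exists C : 'M[F]_n, [/\ \rank C = k, is_MDS C & self_orthogonal C].
Proof.
move=> PE szrs P'sq k_gt0 kn; pose a (j : 'I_n) := rs`_j.
have {}PE : P = \prod_j ('X - (a j)%:P) by rewrite PE (big_nth 0) big_mkord szrs.
have P'a j : P^`().[a j] = \prod_(i | i != j) (a j - a i).
  rewrite PE (bigD1 j) //= derivM derivXsubC mul1r hornerD hornerM hornerXsubC.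
  rewrite subrr mul0r addr0 horner_prod.
  by apply: eq_bigr => i _; rewrite hornerXsubC.
have root_a j : root P (a j) by rewrite rootE PE horner_prod (bigD1 j) //= hornerXsubC subrr mul0r.
have /fin_all_exists2[v v0 vE] j := P'sq _ (root_a j).
(* A repeated root would make the derivative vanish there, against its being a nonzero square. *)
have inj_a : injective a.
  move=> i j aij; apply/eqP/negPn/negP => ij; have := vE j.
  rewrite P'a (bigD1 i) //= aij subrr mul0r => /esym/eqP.
  by rewrite expf_eq0 (negPf (v0 j)).
have v'0 j : (v j)^-1 != 0 by rewrite invr_eq0.
have k_le : (k <= n)%N by lia.
exists <<grs_mx k a (fun j => (v j)^-1)>>%MS; split.
- by rewrite mxrank_gen rank_grs_mx.
- by apply: grs_MDS; rewrite // k_gt0.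
- by apply: grs_self_orthogonal => // j; rewrite exprVn -vE P'a.
Qed.

(** The list may have repetitions; simplicity of the roots comes from the nonvanishing
    derivative. *)
Definition splits (F : fieldType) (P : {poly F}) :=
  exists rs : seq F, P = \prod_(x <- rs) ('X - x%:P).

Lemma splitsM (F : fieldType) (P Q : {poly F}) : splits P -> splits Q -> splits (P * Q).
Proof. by move=> [rs ->] [rs' ->]; exists (rs ++ rs'); rewrite big_cat. Qed.

Lemma splits_prod (F : fieldType) (I : finType) (P : I -> {poly F}) :
  (forall i, splits (P i)) -> splits (\prod_i P i).
Proof.
move=> splitsP; elim/big_ind: _ => //; last exact: splitsM.
by exists [::]; rewrite big_nil.
Qed.

(** With [q = #|F|], the polynomial divides [X^(f e) - c^e = X^(q-1) - 1], hence [X^q - X], the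
    product of all monic linear factors over [F]. *)
Lemma splits_XnsubC (F : finFieldType) (c : F) (e f : nat) :
  (0 < f)%N -> (f * e)%N = #|F|.-1 -> c ^+ e = 1 -> splits ('X^f - c%:P).
Proof.
move=> f_gt0 fe ce.
have dvdP : 'X^f - c%:P %| \prod_(x : F) ('X - x%:P).
  rewrite -finField_genPoly -(ltn_predK (finNzRing_gt1 F)) exprS -fe.
  have -> : 'X * 'X^(f * e) - 'X = 'X * (('X^f) ^+ e - c%:P ^+ e) :> {poly F}.
    by rewrite -rmorphXn ce mulrBr mulr1 exprM.
  by rewrite subrXX mulrCA dvdp_mulr.
have [m] := dvdp_prod_XsubC dvdP.
rewrite eqp_monic ?monic_prod_XsubC ?monicXnsubC // => /eqP ->.
by exists (mask m (index_enum F)).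
Qed.

(** Multiplying the derivative by [x] turns [f x^(f-1)] into [f c]; the other term of the product
    rule vanishes at [x]. *)
Lemma deriv_XnsubC_mul (F : fieldType) (f : nat) (c x : F) (Q : {poly F}) :
    (0 < f)%N -> x ^+ f = c ->
  x * (('X^f - c%:P) * Q)^`().[x] = f%:R * c * Q.[x].
Proof.
move=> f_gt0 xf; rewrite derivM derivB derivXn derivC subr0 hornerD !hornerM.
rewrite hornerD hornerN hornerXn hornerC xf subrr mul0r addr0.
have -> : c = x * x ^+ f.-1 by rewrite -exprS prednK.
by rewrite hornerMn hornerXn -mulr_natl; ring.
Qed.

(** * The quadratic character in a field of square order *)

Lemma finField_prim_root (F : finFieldType) :
  exists z : F, (#|F|.-1).-primitive_root z.
Proof.
have F_gt1 : (1 < #|F|)%N by apply: finNzRing_gt1.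
have /hasP[z _ zP] : has (#|F|.-1).-primitive_root (enum (predC1 (0 : F))); last by exists z.
apply: cyclic.has_prim_root; rewrite ?enum_uniq -?cardE ?cardC1 // -?subn1 ?subn_gt0 //.
apply/allP => x; rewrite mem_enum inE => x0; apply/unity_rootP.
by apply: (mulfI x0); rewrite -exprS subn1 prednK ?expf_card ?mulr1 // ltnW.
Qed.

(* The quadratic character, with values in F. *)
Definition euler (F : finFieldType) (x : F) : F := x ^+ (#|F|.-1)./2.

Lemma eulerM (F : finFieldType) (x y : F) : euler (x * y) = euler x * euler y.
Proof. exact: exprMn. Qed.

Lemma euler_prod (F : finFieldType) (I : finType) (P : pred I) (G : I -> F) :
  euler (\prod_(i | P i) G i) = \prod_(i | P i) euler (G i).
Proof. by rewrite /euler prodrXl. Qed.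

(** In terms of a generator [z], [x = z^i] and the hypothesis says that [q - 1] divides [i (q-1)/2],
    so [i] is even. *)
Lemma euler_square (F : finFieldType) (x : F) :
    odd #|F| -> euler x = 1 ->
  exists2 v, v != 0 & x = v ^+ 2.
Proof.
move=> oddF; have F_gt1 : (1 < #|F|)%N by apply: finNzRing_gt1.
have qE : (#|F|.-1)./2.*2 = #|F|.-1 by lia.
have [z zP] := finField_prim_root F.
rewrite /euler => ex; have x1 : x ^+ #|F|.-1 = 1 by rewrite -qE -muln2 exprM ex expr1n.
have [i xi] := prim_rootP zP x1.
move: ex; rewrite xi -exprM => /eqP; rewrite -(prim_order_dvd zP) -{1}qE -mul2n.
rewrite dvdn_pmul2r; last by lia.
move=> /dvdnP[j ij]; exists (z ^+ j); last by rewrite -exprM -ij.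
by rewrite expf_neq0 // (prim_root_eq0 zP); lia.
Qed.

(** [r] is a power of the characteristic, so raising to the power [r] is an iterate of Frobenius. *)
Lemma exprB_sqrt_card (F : finFieldType) (r : nat) (x y : F) :
    odd_prime_power r -> #|F| = (r ^ 2)%N ->
  (x - y) ^+ r = x ^+ r - y ^+ r.
Proof.
move=> [r_odd [p [m [p_prime m_gt0 rE]]]] cardF.
have pF : p \in GRing.pchar F.
  by apply: (card_finPcharP (n := m * 2)) => //; rewrite cardF rE expnM.
have r_pF : (GRing.pchar F).-nat r by rewrite rE pnatX (eq_pnat _ (pcharf_eq pF)) pnat_id.
by rewrite exprDn_pchar // exprNn_pchar.
Qed.

Lemma half_card_pred (F : finFieldType) (r : nat) :
    odd r -> #|F| = (r ^ 2)%N ->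
  (#|F|.-1)./2 = (r.-1 * (r.+1)./2)%N.
Proof.
move=> r_odd ->; have [m ->] : exists m, r = m.*2.+1.
  by exists r./2; rewrite -[LHS]odd_double_half r_odd.
by rewrite -[RHS]doubleK; congr half; nia.
Qed.

(** The condition on [x] describes the nonzero elements of the subfield of order [r], and [r - 1]
    divides [(q-1)/2]. *)
Lemma euler_fixed (F : finFieldType) (r : nat) (x : F) :
    odd r -> #|F| = (r ^ 2)%N -> x ^+ r.-1 = 1 ->
  euler x = 1.
Proof.
by move=> r_odd cardF xr; rewrite /euler (half_card_pred r_odd cardF) exprM xr expr1n.
Qed.

Lemma eulerB_fixed (F : finFieldType) (r : nat) (x y : F) :
    odd_prime_power r -> #|F| = (r ^ 2)%N ->
    x ^+ r.-1 = 1 -> y ^+ r.-1 = 1 -> x != y ->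
  euler (x - y) = 1.
Proof.
move=> ppr cardF xr yr xy; have r_odd := ppr.1.
have r_gt0 : (0 < r)%N by rewrite odd_gt0.
apply: (euler_fixed r_odd cardF); apply: (@mulfI _ (x - y)); first by rewrite subr_eq0.
rewrite -exprS prednK // (exprB_sqrt_card _ _ ppr cardF).
by rewrite -(prednK r_gt0) !exprS xr yr !mulr1.
Qed.

(** Both elements have norm 1, so [x^r = 1/x], [y^r = 1/y] and [(x-y)^(r-1) = -1/(x y)]. Raising
    this to the power [(r+1)/2] leaves only signs, those of [x] and [y] being recorded by [i] and
    [j]. *)
Lemma eulerB_norm1 (F : finFieldType) (r : nat) (x y : F) (i j : nat) :
    odd_prime_power r -> #|F| = (r ^ 2)%N ->
    x ^+ (r.+1)./2 = (-1) ^+ i -> y ^+ (r.+1)./2 = (-1) ^+ j -> x != y ->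
  euler (x - y) = (-1) ^+ ((r.+1)./2 + i + j).
Proof.
move=> ppr cardF xi yj xy; have r_odd := ppr.1.
have rE : ((r.+1)./2.*2 = r.+1)%N by lia.
have r_gt0 : (0 < r)%N by rewrite odd_gt0.
have norm1 (u : F) k : u ^+ (r.+1)./2 = (-1) ^+ k -> u * u ^+ r = 1.
  by move=> uk; rewrite -exprS -rE -muln2 exprM uk sqrr_sign.
have xr := norm1 _ _ xi; have yr := norm1 _ _ yj.
have d1 : (x - y) ^+ r.-1 * (x * y) = -1.
  apply: (@mulfI _ (x - y)); first by rewrite subr_eq0.
  have -> : (x - y) * ((x - y) ^+ r.-1 * (x * y)) = (x - y) ^+ r * (x * y).
    by rewrite -[in RHS](prednK r_gt0) exprS mulrA.
  rewrite (exprB_sqrt_card _ _ ppr cardF).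
  have -> : (x ^+ r - y ^+ r) * (x * y) = x * x ^+ r * y - x * (y * y ^+ r) by ring.
  by rewrite xr yr; ring.
rewrite /euler (half_card_pred r_odd cardF) exprM.
have : ((x - y) ^+ r.-1) ^+ (r.+1)./2 * (x ^+ (r.+1)./2 * y ^+ (r.+1)./2)
       = (-1) ^+ (r.+1)./2 by rewrite -!exprMn d1.
rewrite xi yj !exprD => <-; set d := _ ^+ (r.+1)./2.
have -> : d * ((-1) ^+ i * (-1) ^+ j) * (-1) ^+ i * (-1) ^+ j
          = d * (((-1) ^+ i) ^+ 2 * ((-1) ^+ j) ^+ 2) by ring.
by rewrite !sqrr_sign !mulr1.
Qed.

(* Summing over F is invariant under the translation x |-> x + 1. *)
Lemma natr_card (F : finFieldType) : (#|F|%:R : F) = 0.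
Proof.
have : \sum_(x : F) x = \sum_(x : F) x + #|F|%:R.
  by rewrite {1}(reindex_inj (@addIr F 1)) big_split sumr_const.
by move/eqP; rewrite -[X in X == _]addr0 (inj_eq (addrI _)) => /eqP.
Qed.

Lemma euler_natr (F : finFieldType) (r e f : nat) :
    odd_prime_power r -> #|F| = (r ^ 2)%N -> (e * f)%N = #|F|.-1 ->
  euler (f%:R : F) = 1.
Proof.
move=> ppr cardF ef; have r_odd := ppr.1; have r_gt0 : (0 < r)%N by rewrite odd_gt0.
(* [f%:R] lies in the prime field; the induction writes [f + 1] as [f - (-1)] in order to use
   [exprB_sqrt_card]. *)
have fr : (f%:R : F) ^+ r = f%:R.
  have zr : (0 : F) ^+ r = 0 by rewrite expr0n; case: (r) r_gt0.
  have Nr (x : F) : (- x) ^+ r = - x ^+ r.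
    by rewrite -sub0r (exprB_sqrt_card _ _ ppr cardF) zr sub0r.
  elim: f {ef} => // f IHf; have -> : f.+1%:R = f%:R - -1 :> F by rewrite opprK natr1.
  by rewrite (exprB_sqrt_card _ _ ppr cardF) IHf Nr expr1n.
apply: (euler_fixed r_odd cardF); apply: (@mulfI _ (f%:R : F)).
  (* If [f] vanished in [F], then [q = e f + 1] would equal 1 there, whereas [q] is 0 in [F]. *)
  apply: contra_eq_neq (natr_card F) => f0.
  by rewrite -(ltn_predK (finNzRing_gt1 F)) -natr1 -ef natrM f0 mulr0 add0r oner_eq0.
by rewrite -exprS prednK // fr mulr1.
Qed.

(** * Arithmetic of the indices *)

(** Since [2^l] divides the gcd [g] and is the exact power of 2 in [e1], [a1] is odd; [l >= 2] gives
    [g = 4 u]. Coprimality of [a1] and [a2] then yields that [a2] divides [f1], [a1] divides [r + 1]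
    and [2 a2] divides [r - 1]. *)
Lemma index_factorization (r e1 f1 e2 f2 l : nat) :
    odd r -> (0 < e1)%N -> (0 < e2)%N ->
    (r ^ 2 - 1 = e1 * f1)%N -> (r ^ 2 - 1 = e2 * f2)%N ->
    (2 <= l)%N -> (e1 %% 2 ^ l.+1 = 2 ^ l)%N -> (2 ^ l %| e2)%N ->
    (2 * e2 %| e1 * (r - 1))%N -> (e1 %| e2 * (r + 1))%N ->
  let a1 := (e1 %/ gcdn e1 e2)%N in let a2 := (e2 %/ gcdn e1 e2)%N in
  exists u w m h,
    [/\ odd a1, f1 = (a2 * w)%N, f2 = (a1 * w)%N, (r ^ 2 - 1 = 4 * u * a1 * a2 * w)%N
      & r.+1 = (2 * (a1 * m))%N /\ r.-1 = (2 * (a2 * h))%N].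
Proof.
move=> r_odd e1_gt0 e2_gt0 ef1 ef2 l_ge2 e1_mod e2_dvd dvd_e2 dvd_e1 a1 a2.
set g := gcdn e1 e2 in a1 a2 *.
have g_gt0 : (0 < g)%N by rewrite gcdn_gt0 e1_gt0.
have e1E : (e1 = a1 * g)%N by rewrite divnK ?dvdn_gcdl.
have e2E : (e2 = a2 * g)%N by rewrite divnK ?dvdn_gcdr.
have a1_gt0 : (0 < a1)%N by move: e1_gt0; rewrite e1E muln_gt0 => /andP[].
have a2_gt0 : (0 < a2)%N by move: e2_gt0; rewrite e2E muln_gt0 => /andP[].
have cop : coprime a1 a2.
  by rewrite /coprime -(eqn_pmul2r g_gt0) muln_gcdl -e1E -e2E mul1n.
have e1_dvd : (2 ^ l %| e1)%N.
  by rewrite (divn_eq e1 (2 ^ l.+1)) e1_mod dvdn_addr // dvdn_mull // dvdn_exp2l.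
have g_dvd : (2 ^ l %| g)%N by rewrite dvdn_gcd e1_dvd.
have a1_odd : odd a1.
  apply/negPn/negP => a1_even; have : (2 ^ l.+1 %| e1)%N.
    by rewrite e1E expnS dvdn_mul // dvdn2.
  by rewrite /dvdn e1_mod expn_eq0.
have /dvdnP[u gE] : (4 %| g)%N by apply: dvdn_trans g_dvd; apply: (@dvdn_exp2l 2 2).
have f1a1 : (f1 * a1 = f2 * a2)%N.
  by apply/eqP; rewrite -(eqn_pmul2r g_gt0) -!mulnA -e1E -e2E mulnC -ef1 ef2 mulnC.
have /dvdnP[w f1E] : (a2 %| f1)%N by rewrite -(@Gauss_dvdl _ _ a1) 1?coprime_sym // f1a1 dvdn_mull.
have f2E : f2 = (a1 * w)%N.
  by apply/eqP; rewrite -(eqn_pmul2r a2_gt0) -f1a1 f1E; apply/eqP; lia.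
have a1_r : (2 * a1 %| r.+1)%N.
  rewrite Gauss_dvd ?coprime2n // dvdn2 /= r_odd /= -(@Gauss_dvdr _ a2) //.
  by rewrite -(@dvdn_pmul2r g) // -e1E mulnAC -e2E -addn1.
have a2_r : (2 * a2 %| r.-1)%N.
  rewrite -(@Gauss_dvdr _ a1); last by rewrite coprimeMl coprime2n a1_odd coprime_sym.
  by rewrite -(@dvdn_pmul2r g) // -mulnA -e2E mulnAC -e1E -subn1.
have [m mE] := dvdnP a1_r; have [h hE] := dvdnP a2_r.
exists u, w, m, h; split=> //; last by rewrite mE hE ![(_ * (2 * _))%N]mulnC -!mulnA.
- by rewrite f1E mulnC.
- by rewrite ef1 f1E e1E gE; ring.
Qed.

(** * The polynomial carrying the evaluation points, and its derivative *)

(** At a root of the factor of index [i] only the derivative of that factor contributes, and each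
    other factor takes the value [y i - y j]. *)
Lemma deriv_prod_XnsubC_mul (F : fieldType) (f s : nat) (y : 'I_s -> F) (Q : {poly F})
    (x : F) (i : 'I_s) :
    (0 < f)%N -> x ^+ f = y i ->
  x * ((\prod_i ('X^f - (y i)%:P)) * Q)^`().[x]
    = f%:R * y i * (\prod_(j | j != i) (y i - y j) * Q.[x]).
Proof.
move=> f_gt0 xf; rewrite (bigD1 i) //= -[_ * _ * Q]mulrA (deriv_XnsubC_mul _ f_gt0 xf).
rewrite hornerM horner_prod.
by congr (_ * (_ * _)); apply: eq_bigr => j _; rewrite hornerD hornerN hornerXn hornerC xf.
Qed.

Lemma root_prod_XnsubC (F : fieldType) (f s : nat) (y : 'I_s -> F) (x : F) :
  root (\prod_i ('X^f - (y i)%:P)) x -> exists i, x ^+ f = y i.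
Proof.
rewrite rootE horner_prod => /prodf_eq0[i _].
by rewrite hornerD hornerN hornerXn hornerC subr_eq0 => /eqP; exists i.
Qed.

Lemma size_prod_XnsubC (F : fieldType) (f s : nat) (y : 'I_s -> F) :
  (0 < f)%N -> size (\prod_i ('X^f - (y i)%:P)) = (s * f).+1.
Proof.
move=> f_gt0; rewrite size_prod => [|i _]; last exact/monic_neq0/monicXnsubC.
rewrite (eq_bigr (fun=> f.+1)) => [|i _]; last by rewrite size_XnsubC.
by rewrite sum_nat_const card_ord; lia.
Qed.

Lemma euler_prod_XnsubC0 (F : finFieldType) (f s : nat) (y : 'I_s -> F) :
    (0 < f)%N -> (forall i, euler (- y i) = 1) ->
  euler (\prod_i ('X^f - (y i)%:P)).[0] = 1.
Proof.
move=> f_gt0 ey; rewrite horner_prod euler_prod big1 // => i _.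
by rewrite hornerD hornerN hornerXn hornerC expr0n eqn0Ngt f_gt0 add0r.
Qed.

(** The conditions on [P.[0]] and on [euler x] serve the polynomial ['X * P], whose derivative is
    [P(0)] at 0 and [x P'(x)] at a root [x] of [P]. *)
Lemma square_deriv_poly (F : finFieldType) (r u a1 a2 w m h s t : nat) :
    odd_prime_power r -> #|F| = (r ^ 2)%N ->
    (#|F|.-1 = 4 * u * a1 * a2 * w)%N -> odd a1 ->
    r.+1 = (2 * (a1 * m))%N -> r.-1 = (2 * (a2 * h))%N ->
    (s <= a1)%N -> (t <= a2)%N -> ~~ odd (s.-1 * (a1 * m)) ->
  exists P : {poly F},
    [/\ splits P, size P = (s * (a2 * w) + t * (a1 * w)).+1, euler P.[0] = 1
      & forall x, root P x -> euler x = 1 /\ euler P^`().[x] = 1].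
Proof.
move=> ppr cardF qE a1_odd r1 r2 s_le t_le par.
have q_gt0 : (0 < #|F|.-1)%N by rewrite -subn1 subn_gt0 finNzRing_gt1.
have NE : (#|F|.-1)./2 = (2 * u * a1 * a2 * w)%N.
  have -> : (#|F|.-1 = (2 * u * a1 * a2 * w).*2)%N by rewrite -muln2 qE; ring.
  by rewrite doubleK.
have [u_gt0 a1_gt0 a2_gt0 w_gt0] : [/\ 0 < u, 0 < a1, 0 < a2 & 0 < w]%N.
  by move: q_gt0; rewrite qE !muln_gt0 => /andP[/andP[/andP[]]].
have f1_gt0 : (0 < a2 * w)%N by rewrite muln_gt0 a2_gt0.
have f2_gt0 : (0 < a1 * w)%N by rewrite muln_gt0 a1_gt0.
have RE : (r.+1)./2 = (a1 * m)%N by rewrite r1 mul2n doubleK.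
have [th thP] := finField_prim_root F.
have th1 := prim_expr_order thP.
have th_neq1 : th ^+ (2 * u * a1 * a2 * w) != 1.
  have N_gt0 : (0 < 2 * u * a1 * a2 * w)%N by rewrite !muln_gt0 u_gt0 a1_gt0 a2_gt0.
  rewrite -(prim_order_dvd thP) gtnNdvd // qE.
  have -> : (4 * u * a1 * a2 * w = 2 * u * a1 * a2 * w + 2 * u * a1 * a2 * w)%N by ring.
  by rewrite -[ltnLHS]addn0 ltn_add2l.
have thN : th ^+ (2 * u * a1 * a2 * w) = -1.
  have /eqP : (th ^+ (2 * u * a1 * a2 * w)) ^+ 2 = 1.
    by rewrite -exprM -[RHS]th1 qE; congr (_ ^+ _); ring.
  by rewrite sqrf_eq1 (negPf th_neq1) => /eqP.
have N1_neq1 : (-1 : F) != 1 by rewrite -thN.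
have eulerX (x : F) n k : x ^+ n = 1 -> (2 * u * a1 * a2 * w = n * k)%N -> euler x = 1.
  by move=> xn Nnk; rewrite /euler NE Nnk exprM xn expr1n.
have e1N : euler (-1 : F) = 1.
  by apply: (eulerX _ 2 (u * a1 * a2 * w)%N); [rewrite sqrrN expr1n | ring].
(* As [th] has order [4 u a1 a2 w], the [y i] are powers of an element of order [a1], and the [z j]
   are odd powers of an element of order [2 a2]. *)
pose y (i : 'I_s) := th ^+ (4 * u * a2 * w * i).
pose z (j : 'I_t) := th ^+ (2 * u * a1 * w * j.*2.+1).
have ya1 i : y i ^+ a1 = 1.
  rewrite -exprM (_ : _ * a1 = #|F|.-1 * i)%N; last by rewrite qE; ring.
  by rewrite exprM th1 expr1n.
have za2 j : z j ^+ a2 = -1.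
  rewrite -exprM (_ : _ * a2 = 2 * u * a1 * a2 * w * j.*2.+1)%N; last by ring.
  by rewrite exprM thN -signr_odd /= odd_double.
have y_inj i j : i != j -> y i != y j.
  have lt_q (k : 'I_s) : (4 * u * a2 * w * k < #|F|.-1)%N.
    have kc : (k < a1)%N by apply: leq_trans (ltn_ord k) s_le.
    rewrite qE (_ : 4 * u * a1 * a2 * w = 4 * u * a2 * w * a1)%N; last by ring.
    by rewrite ltn_pmul2l // !muln_gt0 u_gt0 a2_gt0.
  apply: contraNneq => /eqP yij; apply/eqP/val_inj/eqP; move: yij.
  rewrite (eq_prim_root_expr thP) !modn_small //.
  by rewrite eqn_pmul2l // !muln_gt0 u_gt0 a2_gt0.
have z_inj i j : i != j -> z i != z j.
  have lt_q (k : 'I_t) : (2 * u * a1 * w * k.*2.+1 < #|F|.-1)%N.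
    have kc : (k < a2)%N by apply: leq_trans (ltn_ord k) t_le.
    rewrite qE (_ : 4 * u * a1 * a2 * w = 2 * u * a1 * w * a2.*2)%N; last by rewrite -muln2; ring.
    by rewrite ltn_pmul2l ?ltn_Sdouble // !muln_gt0 u_gt0 a1_gt0.
  apply: contraNneq => /eqP yij; apply/eqP/val_inj/eqP; move: yij.
  rewrite (eq_prim_root_expr thP) !modn_small //.
  by rewrite eqn_pmul2l ?eqSS ?(inj_eq double_inj) // !muln_gt0 u_gt0 a1_gt0.
have ey i : euler (y i) = 1 by apply: (eulerX _ _ (2 * u * a2 * w)%N (ya1 i)); ring.
have za2_2 j : z j ^+ (a2 * 2) = 1 by rewrite exprM za2 sqrrN expr1n.
have ez j : euler (z j) = 1 by apply: (eulerX _ _ (u * a1 * w)%N (za2_2 j)); ring.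
have fixed (x : F) : x ^+ (a2 * 2) = 1 -> x ^+ r.-1 = 1.
  move=> xa; have -> : (r.-1 = a2 * 2 * h)%N by rewrite r2; ring.
  by rewrite exprM xa expr1n.
have ef1 : euler ((a2 * w)%:R : F) = 1.
  by apply: (euler_natr (e := (4 * u * a1)%N) ppr cardF); rewrite qE; ring.
have ef2 : euler ((a1 * w)%:R : F) = 1.
  by apply: (euler_natr (e := (4 * u * a2)%N) ppr cardF); rewrite qE; ring.
pose P1 : {poly F} := \prod_i ('X^(a2 * w) - (y i)%:P).
pose P2 : {poly F} := \prod_j ('X^(a1 * w) - (z j)%:P).
exists (P1 * P2); split.
- apply: splitsM; apply: splits_prod => i.
    apply: (@splits_XnsubC _ _ (a1 * (4 * u))) => //; first by rewrite qE; ring.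
    by rewrite exprM ya1 expr1n.
  apply: (@splits_XnsubC _ _ (a2 * 2 * (2 * u))) => //; first by rewrite qE; ring.
  by rewrite exprM za2_2 expr1n.
- rewrite size_mul -?size_poly_eq0 ?size_prod_XnsubC //=.
  by rewrite addnS.
- rewrite hornerM eulerM !euler_prod_XnsubC0 ?mulr1 // => i.
    by rewrite -mulN1r eulerM e1N ez mulr1.
  by rewrite -mulN1r eulerM e1N ey mulr1.
move=> x; rewrite rootM => /orP[] /root_prod_XnsubC[i xi].
  have xa : x ^+ (a1 * a2 * w) = 1 by rewrite -[RHS](ya1 i) -xi -exprM; congr (_ ^+ _); ring.
  have ex : euler x = 1 by apply: (eulerX _ _ (2 * u)%N xa); ring.
  (* As [euler x = 1], the character of [P'(x)] is that of [x P'(x)], which has a factored form. *)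
  split=> //; rewrite -[LHS]mul1r -{1}ex -eulerM (deriv_prod_XnsubC_mul _ f1_gt0 xi).
  rewrite !eulerM ef1 ey !mul1r euler_prod (eq_bigr (fun=> (-1) ^+ (a1 * m))); last first.
    move=> j ji; have yR k : y k ^+ (r.+1)./2 = (-1) ^+ 0 by rewrite RE exprM ya1 expr1n.
    by rewrite (eulerB_norm1 ppr cardF (yR i) (yR j)) ?RE ?addn0 // y_inj // eq_sym.
  (* Each of the [s - 1] differences [y i - y j] has character [(-1)^(a1 m)], where
     [a1 m = (r+1)/2]; [par] makes their product 1. *)
  rewrite prodr_const cardC1 card_ord -exprM -signr_odd mulnC (negPf par) expr0 mul1r.
  rewrite horner_prod euler_prod big1 // => j _.
  rewrite hornerD hornerN hornerXn hornerC.
  (* The [2 a2]-th powers of [x^(a1 w)] and [z j] are 1 and [2 a2] divides [r - 1], so both lie in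
     the subfield of order [r]. They differ because their [a2]-th powers are 1 and -1. *)
  have xf2 : (x ^+ (a1 * w)) ^+ a2 = 1 by rewrite -exprM -[RHS]xa; congr (_ ^+ _); ring.
  have xz : x ^+ (a1 * w) != z j.
    by apply: contraNneq N1_neq1 => xz; rewrite -(za2 j) -xz xf2.
  by apply: (eulerB_fixed ppr cardF _ _ xz); apply: fixed; rewrite // exprM xf2 expr1n.
have xa : x ^+ (a1 * a2 * w) = -1.
  by rewrite -[RHS](za2 i) -xi -exprM; congr (_ ^+ _); ring.
have ex : euler x = 1.
  apply: (eulerX _ (a1 * a2 * w * 2)%N u); last by ring.
  by rewrite exprM xa sqrrN expr1n.
split=> //; rewrite -[LHS]mul1r -{1}ex -eulerM [P1 * P2]mulrC.
rewrite (deriv_prod_XnsubC_mul _ f2_gt0 xi) !eulerM ef2 ez !mul1r euler_prod big1 => [|j ji].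
  rewrite mul1r horner_prod euler_prod big1 // => j _.
  rewrite hornerD hornerN hornerXn hornerC.
  (* Here [x^(a1 a2 w) = -1] produces the sign [(-1)^m], and the resulting character
     [(-1)^(a1 m + m)] is 1 because [a1] is odd. *)
  have xR : (x ^+ (a2 * w)) ^+ (r.+1)./2 = (-1) ^+ m.
    by rewrite RE -xa -!exprM; congr (_ ^+ _); ring.
  have yR : y j ^+ (r.+1)./2 = (-1) ^+ 0 by rewrite RE exprM ya1 expr1n.
  rewrite (eulerB_norm1 ppr cardF xR yR) ?RE ?addn0.
    by rewrite -signr_odd oddD oddM a1_odd addbb.
  apply: contraNneq N1_neq1 => xy; apply/eqP.
  by rewrite -[RHS](ya1 j) -xa -xy -exprM; congr (_ ^+ _); ring.
by apply: (eulerB_fixed ppr cardF); [exact: fixed | exact: fixed | rewrite z_inj // eq_sym].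
Qed.

(** * From the polynomials to the codes *)

Lemma euler_square_code (F : finFieldType) (P : {poly F}) (n k : nat) :
    odd #|F| -> splits P -> size P = n.+1 ->
    (forall x, root P x -> euler P^`().[x] = 1) -> (0 < k)%N -> (k.*2 <= n)%N ->
  exists C : 'M[F]_n, [/\ \rank C = k, is_MDS C & self_orthogonal C].
Proof.
move=> oddF [rs PE] szP eP'; apply: (deriv_square_code PE).
  by apply: succn_inj; rewrite -szP PE size_prod_XsubC.
by move=> x /eP'/(euler_square oddF).
Qed.

Theorem theorem3 (r e1 f1 e2 f2 l s t : nat) (F : finFieldType) :
  odd_prime_power r ->
  #|F| = (r ^ 2)%N ->
  (0 < e1)%N -> (0 < f1)%N -> (0 < e2)%N -> (0 < f2)%N ->
  (r ^ 2 - 1 = e1 * f1)%N -> (r ^ 2 - 1 = e2 * f2)%N ->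
  (2 <= l)%N ->
  (e1 %% 2 ^ l.+1 = 2 ^ l)%N -> (2 ^ l %| e2)%N ->
  (2 * e2 %| e1 * (r - 1))%N -> (e1 %| e2 * (r + 1))%N ->
  (1 <= s <= e1 %/ gcdn e1 e2)%N -> (1 <= t <= e2 %/ gcdn e1 e2)%N ->
  (4 %| (s - 1) * (r + 1))%N ->
  let n1 := (s * f1 + t * f2)%N in
  [/\ (~~ odd n1 -> forall k : nat, (1 <= k <= n1./2 - 1)%N ->
          exists C : 'M[F]_n1, [/\ \rank C = k, is_MDS C & self_orthogonal C]),
      (~~ odd n1 ->
          exists C : 'M[F]_(n1.+1), is_MDS C /\ almost_self_dual C)
    & (~~ odd n1.+1 -> forall k : nat, (1 <= k <= n1.+1./2 - 1)%N ->
          exists C : 'M[F]_(n1.+1), [/\ \rank C = k, is_MDS C & self_orthogonal C])].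
Proof.
move=> ppr cardF e1_gt0 f1_gt0 e2_gt0 f2_gt0 ef1 ef2 l_ge2 e1_mod e2_dvd dvd_e2 dvd_e1.
move=> /andP[s_gt0 s_le] /andP[t_gt0 t_le] par n1.
have r_odd := ppr.1; have oddF : odd #|F| by rewrite cardF oddX.
have [u [w [m [h [a1_odd f1E f2E qE [r1 r2]]]]]] :=
  index_factorization r_odd e1_gt0 e2_gt0 ef1 ef2 l_ge2 e1_mod e2_dvd dvd_e2 dvd_e1.
have {}qE : (#|F|.-1 = 4 * u * (e1 %/ gcdn e1 e2) * (e2 %/ gcdn e1 e2) * w)%N.
  by rewrite -qE cardF subn1.
(* As [r + 1 = 2 a1 m], divisibility of [(s-1)(r+1)] by 4 means that [(s-1) a1 m] is even. *)
have {}par : ~~ odd (s.-1 * (e1 %/ gcdn e1 e2 * m)).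
  move: par; rewrite subn1 addn1 r1 mulnCA (_ : 4 = 2 * 2)%N // dvdn_pmul2l //.
  by rewrite dvdn2.
have [P [splitP]] := square_deriv_poly ppr cardF qE a1_odd r1 r2 s_le t_le par.
rewrite -f1E -f2E -/n1 => szP eP0 eP.
have n1_gt0 : (0 < n1)%N by rewrite addn_gt0 muln_gt0 s_gt0 f1_gt0.
(* Multiplying by ['X] adds 0 as an evaluation point. *)
have splitXP : splits ('X * P).
  by apply: splitsM => //; exists [:: 0]; rewrite big_seq1 subr0.
have szXP : size ('X * P) = n1.+2.
  by rewrite mulrC size_mulX ?szP // -size_poly_gt0 szP.
have eXP x : root ('X * P) x -> euler ('X * P)^`().[x] = 1.
  rewrite rootM rootX derivM derivX mul1r hornerD hornerM hornerX => /orP[/eqP->|Px].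
    by rewrite mul0r addr0.
  have [ex eP'x] := eP x Px.
  by rewrite (rootP Px) add0r eulerM ex eP'x mulr1.
split=> [n1_even k /andP[k_gt0 k_le]|n1_even|n1_odd k /andP[k_gt0 k_le]].
- apply: (euler_square_code oddF splitP szP) => [x /eP[]//|//|].
  by move: n1_gt0 k_le; clearbody n1; clear; lia.
(* Dimension [n1 / 2] in length [n1 + 1] gives a dual of dimension [n1 / 2 + 1]. *)
- have n1E : ((n1./2).*2 = n1)%N by rewrite -[RHS]odd_double_half (negPf n1_even).
  have k_gt0 : (0 < n1./2)%N by rewrite -double_gt0 n1E.
  have k_le : ((n1./2).*2 <= n1.+1)%N by rewrite n1E.
  have [C [rC mdsC soC]] := euler_square_code oddF splitXP szXP eXP k_gt0 k_le.
  exists C; split=> //; split=> //.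
  rewrite /dual_code mxrank_ker mxrank_tr rC addn1.
  by rewrite -{1}n1E -addnn -addSn addnK.
- apply: (euler_square_code oddF splitXP szXP eXP k_gt0).
  by move: n1_gt0 k_le; clearbody n1; clear; lia.
Qed.
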